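(* There is an $n$-uniform cross-intersecting family $H$ with $Q(H) = \{0, 1, 2, n-1\}$ and $\chi(H) = 3$.
   Context: A hypergraph is a pair $(V,E)$ where $V$ is a set of vertices and $E$ is a set of subsets of $V$ (edges); it is $n$-uniform if every edge has exactly $n$ vertices. A cross-intersecting family $H = (V, A, B)$ is a hypergraph with vertex set $V$ and edge set $E = A \cup B$ such that every $a \in A$ intersects every $b \in B$, and $A$, $B$ are not empty. The set of the sizes of pairwise edge intersections is $Q(H) := \{|e_1 \cap e_2| : e_1, e_2 \in E,\ e_1 \neq e_2\}$. A coloring of the vertices is proper if there are no monochromatic edges; the chromatic number $\chi(H)$ is the minimal number of colors that admits a proper coloring. *)

(* Defs.v *)
From mathcomp Require Import all_boot.

Set Implicit Arguments.
Unset Strict Implicit.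
Unset Printing Implicit Defensive.

Section Hypergraphs.
Variable V : finType.
Implicit Types (E A B : {set {set V}}) (e : {set V}).

Definition uniform (n : nat) E : Prop := forall e, e \in E -> #|e| = n.

(* The hypergraph (V, A, B) has edge set A :|: B; A and B may overlap. *)
Definition cross_intersecting A B : Prop :=
  [/\ A != set0, B != set0 &
      forall a b, a \in A -> b \in B -> a :&: b != set0].

Definition intersection_sizes E : pred nat :=
  [pred k | [exists e1 in E, exists e2 in E,
               (e1 != e2) && (#|e1 :&: e2| == k)]].

Definition monochromatic (k : nat) (f : V -> 'I_k) e : Prop :=
  exists c : 'I_k, forall x, x \in e -> f x = c.

Definition proper_coloring (k : nat) (f : V -> 'I_k) E : Prop :=
  forall e, e \in E -> ~ monochromatic f e.

Definition colorable (k : nat) E : Prop :=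
  exists f : V -> 'I_k, proper_coloring f E.

(* A relation rather than a function: a one-vertex edge is
   monochromatic in every coloring, so the minimum need not exist. *)
Definition is_chromatic_number E (k : nat) : Prop :=
  colorable k E /\ forall m, colorable m E -> k <= m.

End Hypergraphs.

(* Main.v *)
Require Import Defs.
From mathcomp Require Import all_boot.

(** Take an [(n-1)]-uniform linear hypergraph [H] (distinct edges share at most
    one vertex) that is not 2-colorable, and an [n]-set [a] disjoint from it.
    Let [A = {a}] and let [B] consist of the sets [v |: e] with [v] in [a] and
    [e] in [H].  In a 2-coloring some [e] is monochromatic, so either some
    [v |: e] is, or [a] is monochromatic in the other color; using two colors on
    [a] and the third one elsewhere is proper.  Linearity of [H] bounds the
    intersection sizes.

    To get [H], one builds more generally linear systems of edges, each with a
    target color, those of target [true] having size [p] and those of target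
    [false] size [q], such that every 2-coloring gives some edge its target
    color throughout.  Sizes [(p+1, q+1)] come from [(p, q+1)] and [(p+1, q)]:
    add a grid [I1 * I2] of new vertices, indexed by the edges of the two smaller
    systems, and extend the short edges of many copies of these by one grid
    vertex each.  Every 2-coloring of the grid either has a vertex of color
    [true] in each row, or a row of constant color [false]; a copy of the first
    or of the second system is extended by these vertices. *)

Set Implicit Arguments.
Unset Strict Implicit.
Unset Printing Implicit Defensive.

Definition linear_system (V I : finType) (e : I -> {set V}) : Prop :=
  forall i j x y, i != j ->
    x \in e i -> x \in e j -> y \in e i -> y \in e j -> x = y.

Definition forcing (V I : finType) (e : I -> {set V}) (c : I -> bool) : Prop :=
  forall f : V -> bool, exists i, forall x, x \in e i -> f x = c i.

(** * The grid construction *)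

Section Step.
Variables (V1 I1 V2 I2 : finType).
Variables (e1 : I1 -> {set V1}) (c1 : I1 -> bool).
Variables (e2 : I2 -> {set V2}) (c2 : I2 -> bool).

(** Besides the grid, there is one copy of the first system for each choice [phi] of a grid vertex
    in every row, and one copy of the second for each row. *)
Definition step_vertex : finType :=
  ((I1 * I2) + ({ffun I1 -> I2} * V1 + I1 * V2))%type.
Definition step_index : finType := ({ffun I1 -> I2} * I1 + I1 * I2)%type.

Definition step_edge (k : step_index) : {set step_vertex} :=
  match k with
  | inl (phi, i) =>
      (if c1 i then [set inl (i, phi i)] else set0) :|:
      [set inr (inl (phi, v)) | v in e1 i]
  | inr (i0, j) =>
      (if c2 j then set0 else [set inl (i0, j)]) :|:
      [set inr (inr (i0, v)) | v in e2 j]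
  end.

Definition step_target (k : step_index) : bool :=
  match k with inl (_, i) => c1 i | inr (_, j) => c2 j end.

Lemma in_step_edge k x :
  (x \in step_edge k) =
  match k, x with
  | inl (phi, i), inl z => c1 i && (z == (i, phi i))
  | inl (phi, i), inr (inl (psi, v)) => (psi == phi) && (v \in e1 i)
  | inr (i0, j), inl z => ~~ c2 j && (z == (i0, j))
  | inr (i0, j), inr (inr (i1, v)) => (i1 == i0) && (v \in e2 j)
  | _, _ => false
  end.
Proof.
case: k => [[phi i]|[i0 j]]; rewrite inE.
- case: x => [z|[[psi v]|w]].
  + rewrite [X in _ || X](_ : _ = false) ?orbF; last by apply/imsetP => -[].
    by case: (c1 i); rewrite ?inE //; apply/eqP/eqP => [[]|->].
  + rewrite [X in X || _](_ : _ = false); last by case: (c1 i); rewrite !inE.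
    apply/imsetP/andP => [[u ue [-> ->]]|[/eqP-> ve]]; first by rewrite eqxx.
    by exists v.
  + rewrite [X in X || _](_ : _ = false); last by case: (c1 i); rewrite !inE.
    by apply/imsetP => -[].
- case: x => [z|[w|[i1 v]]].
  + rewrite [X in _ || X](_ : _ = false) ?orbF; last by apply/imsetP => -[].
    by case: (c2 j); rewrite ?inE //; apply/eqP/eqP => [[]|->].
  + rewrite [X in X || _](_ : _ = false); last by case: (c2 j); rewrite !inE.
    by apply/imsetP => -[].
  + rewrite [X in X || _](_ : _ = false); last by case: (c2 j); rewrite !inE.
    apply/imsetP/andP => [[u ue [-> ->]]|[/eqP-> ve]]; first by rewrite eqxx.
    by exists v.
Qed.

Lemma card_step_edge k :
  #|step_edge k| =
  match k with
  | inl (_, i) => c1 i + #|e1 i|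
  | inr (_, j) => ~~ c2 j + #|e2 j|
  end.
Proof.
case: k => [[phi i]|[i0 j]] /=.
- have inj : injective (fun v => inr (inl (phi, v)) : step_vertex).
    by move=> u v [].
  case: (c1 i); rewrite ?set0U ?cardsU1 (card_imset _ inj) //.
  by congr (nat_of_bool _ + _); apply/imsetP => -[].
- have inj : injective (fun v => inr (inr (i0, v)) : step_vertex).
    by move=> u v [].
  case: (c2 j); rewrite ?set0U ?cardsU1 (card_imset _ inj) //.
  by congr (nat_of_bool _ + _); apply/imsetP => -[].
Qed.

(** An edge has at most one grid vertex, and a grid vertex lies on at most one edge of each copy.
    Hence edges of different copies share at most a grid vertex, and edges of the same copy only
    what they shared before. *)
Lemma step_linear :
  linear_system e1 -> linear_system e2 -> linear_system step_edge.
Proof.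
move=> L1 L2 [[phi i]|[i0 j]] [[psi i']|[i1 j']] x y ne; rewrite !in_step_edge;
  case: x => [z|[[f v]|[g v]]] //; case: y => [z'|[[f' v']|[g' v']]] //.
- by move=> /andP[_ /eqP->] _ /andP[_ /eqP->].
- move=> /andP[_ /eqP->] /andP[_ /eqP[ii _]] /andP[/eqP fp _] /andP[/eqP fq _].
  by rewrite ii -fp fq eqxx in ne.
- move=> /andP[/eqP fp _] /andP[/eqP fq _] /andP[_ /eqP->] /andP[_ /eqP[ii _]].
  by rewrite ii -fp fq eqxx in ne.
- move=> /andP[/eqP fp vi] /andP[/eqP fq vi'] /andP[/eqP-> wi] /andP[_ wi'].
  rewrite fp (L1 i i' v v') //.
  by apply: contra ne => /eqP->; rewrite -fp fq.
- by move=> /andP[_ /eqP->] _ /andP[_ /eqP->].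
- by move=> /andP[_ /eqP->] _ /andP[_ /eqP->].
- by move=> /andP[_ /eqP->] _ /andP[_ /eqP->].
- move=> /andP[_ /eqP->] /andP[_ /eqP[ii jj]].
  by rewrite ii jj eqxx in ne.
- move=> _ _ /andP[_ /eqP->] /andP[_ /eqP[ii jj]].
  by rewrite ii jj eqxx in ne.
- move=> /andP[/eqP fp vi] /andP[/eqP fq vi'] /andP[/eqP-> wi] /andP[_ wi'].
  rewrite fp (L2 j j' v v') //.
  by apply: contra ne => /eqP->; rewrite -fp fq.
Qed.

Lemma step_forcing :
  forcing e1 c1 -> forcing e2 c2 -> forcing step_edge step_target.
Proof.
move=> F1 F2 f.
have [/existsP[i0 /forallP f0]|/existsPn f1] :=
  boolP [exists i, [forall j, ~~ f (inl (i, j))]].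
- have [j fj] := F2 (fun v => f (inr (inr (i0, v)))).
  exists (inr (i0, j)) => x; rewrite in_step_edge /=.
  case: x => [z|[w|[i1 v]]] //.
    by move=> /andP[/negbTE-> /eqP->]; apply: negbTE.
  by move=> /andP[/eqP-> /fj].
- have /fin_all_exists[g fg] : forall i, exists j, f (inl (i, j)).
    by move=> i; have /forallPn[j] := f1 i; rewrite negbK; exists j.
  (* In the copy indexed by this [phi], every grid vertex used as an extension has color [true]. *)
  pose phi := [ffun i => g i].
  have [i fi] := F1 (fun v => f (inr (inl (phi, v)))).
  exists (inl (phi, i)) => x; rewrite in_step_edge /=.
  case: x => [z|[[psi v]|w]] //.
    by move=> /andP[-> /eqP->]; rewrite ffunE fg.
  by move=> /andP[/eqP-> /fi].
Qed.

End Step.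

(** * Linear hypergraphs that are not 2-colorable *)

Lemma forcing_exists p q :
  exists (V I : finType) (e : I -> {set V}) (c : I -> bool),
    [/\ forall i, #|e i| = (if c i then p else q),
        linear_system e & forcing e c].
Proof.
elim: p q => [|p IHp] q.
  (* A single empty edge meets its target vacuously; this settles the base cases of both
     inductions. *)
  exists void, unit, (fun=> set0), (fun=> true); split.
  - by move=> i; rewrite cards0.
  - by move=> i j [].
  - by move=> f; exists tt => -[].
elim: q => [|q [V2 [I2 [e2 [c2 [S2 L2 F2]]]]]].
  exists void, unit, (fun=> set0), (fun=> false); split.
  - by move=> i; rewrite cards0.
  - by move=> i j [].
  - by move=> f; exists tt => -[].
have [V1 [I1 [e1 [c1 [S1 L1 F1]]]]] := IHp q.+1.
exists (step_vertex V1 I1 V2 I2), (step_index I1 I2).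
exists (step_edge e1 c1 e2 c2), (step_target c1 c2); split.
- move=> k; rewrite card_step_edge.
  case: k => [[phi i]|[i0 j]] /=; first by rewrite S1; case: (c1 i).
  by rewrite S2; case: (c2 j).
- exact: step_linear.
- exact: step_forcing.
Qed.

Lemma linear_card (V I : finType) (e : I -> {set V}) i j :
  linear_system e -> i != j -> #|e i :&: e j| <= 1.
Proof.
move=> L ne; apply/card_le1_eqP => x y.
by rewrite !inE => /andP[xi xj] /andP[yi yj]; apply: L yi yj xi xj.
Qed.

(* If the edges were pairwise disjoint, giving one vertex of each edge a special
   color would make no edge monochromatic. *)
Lemma forcing_meet (V I : finType) (e : I -> {set V}) (c : I -> bool) :
  (forall i, 1 < #|e i|) -> forcing e c ->
  exists i j, i != j /\ e i :&: e j != set0.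
Proof.
move=> S F.
have /fin_all_exists2[g g1 /fin_all_exists2[h h1 gh]] :
    forall i, exists2 x, x \in e i & exists2 y, y \in e i & x != y.
  move=> i; have /card_gt1P[x [y [xi yi xy]]] := S i.
  by exists x => //; exists y.
have [i fi] := F (fun x => [exists j, g j == x]).
have fg := fi _ (g1 i); have := fi _ (h1 i); rewrite -fg.
have -> : [exists j, g j == g i] by apply/existsP; exists i.
move=> /existsP[j /eqP gj]; exists i, j; split.
  by apply: contra (gh i) => /eqP ij; rewrite -gj ij.
by apply/set0Pn; exists (h i); rewrite inE h1 -gj g1.
Qed.

(** The case [p = q = k] of [forcing_exists] is uniform. The disjoint pair and the meeting pair will
    realize the intersection sizes 0 and 2. *)
Lemma linear_not_2colorable k : 1 < k ->
  exists (V : finType) (H : {set {set V}}),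
    [/\ uniform k H,
        {in H &, forall e1 e2, e1 != e2 -> #|e1 :&: e2| <= 1},
        forall f : V -> bool, exists2 e, e \in H &
          exists b, forall x, x \in e -> f x = b,
        exists e1 e2, [/\ e1 \in H, e2 \in H & e1 :&: e2 = set0]
      & exists e1 e2, [/\ e1 \in H, e2 \in H & #|e1 :&: e2| = 1]].
Proof.
move=> k1; have [V [I [e [c [S L F]]]]] := forcing_exists k k.
have Sk i : #|e i| = k by rewrite S if_same.
(* Two disjoint copies, in order to have disjoint edges. *)
pose d (p : bool * I) : {set bool * V} := [set (p.1, v) | v in e p.2].
have in_d p b v : ((b, v) \in d p) = (b == p.1) && (v \in e p.2).
  apply/imsetP/andP => [[u ue [-> ->]]|[/eqP-> ve]]; first by rewrite eqxx.
  by exists v.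
have Sd p : #|d p| = k by rewrite card_imset ?Sk // => u v [].
have Ld : linear_system d.
  move=> [s i] [t j] [b v] [b' v'] ne; rewrite !in_d /=.
  move=> /andP[/eqP bs vi] /andP[/eqP bt vj] /andP[/eqP-> v'i] /andP[_ v'j].
  rewrite bs (L i j v v') //.
  by apply: contra ne => /eqP->; rewrite -bs bt.
have in_H p : d p \in [set d p | p : bool * I] by apply: imset_f.
exists (bool * V)%type, [set d p | p : bool * I]; split.
- by move=> _ /imsetP[p _ ->].
- move=> _ _ /imsetP[p _ ->] /imsetP[q _ ->] ne.
  by apply: linear_card => //; apply: contra ne => /eqP->.
- move=> f; have [i fi] := F (fun v => f (true, v)).
  exists (d (true, i)) => //; exists (c i) => -[b v].
  by rewrite in_d /= => /andP[/eqP-> /fi].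
- have [i _] := F (fun=> true).
  exists (d (true, i)), (d (false, i)); split=> //.
  apply/setP => -[b v]; rewrite in_setI !in_d in_set0 /=.
  by case: b; rewrite ?andbF.
- have S1 i : 1 < #|e i| by rewrite Sk.
  have [i [j [ne /set0Pn[v]]]] := forcing_meet S1 F.
  rewrite inE => /andP[vi vj].
  exists (d (true, i)), (d (true, j)); split=> //.
  apply/eqP; rewrite eqn_leq linear_card // /=.
  by apply/card_gt0P; exists (true, v); rewrite in_setI !in_d /= vi vj.
Qed.

(** * The cross-intersecting family *)

Theorem theorem1p12 (n : nat) (hn : 3 <= n) :
  exists (V : finType) (A B : {set {set V}}),
    [/\ cross_intersecting A B,
        uniform n (A :|: B),
        intersection_sizes (A :|: B) =i [:: 0; 1; 2; n - 1]
      & is_chromatic_number (A :|: B) 3].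
Proof.
case: n hn => [//|k]; rewrite ltnS subn1 /= => k1.
have [W [H [SH LH FH [d1 [d2 [d1H d2H d12]]] [m1 [m2 [m1H m2H m12]]]]]] :=
  linear_not_2colorable k1.
pose V : finType := ('I_k.+1 + W)%type.
pose a : {set V} := [set inl v | v : 'I_k.+1].
pose b (v : 'I_k.+1) (e : {set W}) : {set V} := inl v |: [set inr w | w in e].
have in_al v : inl v \in a by apply: imset_f.
have in_ar w : (inr w \in a) = false by apply/imsetP => -[].
have in_bl v e u : (inl u \in b v e) = (u == v).
  rewrite !inE [X in _ || X](_ : _ = false) ?orbF; last by apply/imsetP => -[].
  by apply/eqP/eqP => [[]|->].
have in_br v e w : (inr w \in b v e) = (w \in e).
  by rewrite !inE mem_imset // => x y [].
have card_b v e : #|b v e| = #|e|.+1.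
  rewrite cardsU1 card_imset => [|x y []//].
  by rewrite (_ : _ \notin _ = true) //; apply/imsetP => -[].
have card_a : #|a| = k.+1.
  by rewrite card_imset ?card_ord // => x y [].
have ab v e : a :&: b v e = [set inl v].
  apply/setP => -[u|w]; rewrite in_setI in_set1 ?in_al ?in_ar ?in_bl /=.
    by apply/eqP/eqP => [->|[]].
  by [].
have bb v e e' : b v e :&: b v e' = b v (e :&: e').
  by apply/setP => -[u|w]; rewrite in_setI !(in_bl, in_br) ?in_setI ?andbb.
have bb' v v' e e' : v != v' -> #|b v e :&: b v' e'| = #|e :&: e'|.
  have inj : injective (@inr 'I_k.+1 W) by move=> x y [].
  move=> ne; rewrite -(card_imset (mem (e :&: e')) inj).
  apply: eq_card => -[u|w]; rewrite in_setI !(in_bl, in_br).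
    rewrite (_ : (_ \in imset _ _) = false); last by apply/imsetP => -[].
    by apply: contraNF ne => /andP[/eqP<- /eqP->].
  by rewrite (mem_imset _ _ inj) in_setI.
pose A := [set a]; pose B : {set {set V}} := [set b p.1 p.2 | p in setX setT H].
have inB v e : e \in H -> b v e \in B.
  by move=> eH; apply/imsetP; exists (v, e); rewrite ?inE.
have BP x : x \in B -> exists v e, e \in H /\ x = b v e.
  by case/imsetP => -[v e]; rewrite !inE /= => eH ->; exists v, e.
pose o : 'I_k.+1 := ord0; pose o' : 'I_k.+1 := ord_max.
have oo' : o != o' by rewrite -val_eqE /= eq_sym -lt0n ltnW.
have aAB : a \in A :|: B by rewrite !inE eqxx.
have bAB v e : e \in H -> b v e \in A :|: B by move=> eH; rewrite inE inB ?orbT.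
have ABP x : x \in A :|: B -> x = a \/ exists v e, e \in H /\ x = b v e.
  by rewrite in_setU1 => /orP[/eqP|/BP]; [left|right].
have neq_b v v' e e' : v != v' -> b v e != b v' e'.
  by apply: contra => /eqP/setP/(_ (inl v)); rewrite !in_bl eqxx => <-.
exists V, A, B; split.
- split.
  + by apply/set0Pn; exists a; rewrite inE.
  + by apply/set0Pn; exists (b o d1); apply: inB.
  + move=> _ _ /set1P-> /BP[v [e [_ ->]]].
    by apply/set0Pn; exists (inl v); rewrite ab inE.
- by move=> _ /ABP[->//|[v [e [eH ->]]]]; rewrite card_b SH.
- move=> q; apply/idP/idP.
  + case/exists_inP=> x /ABP xP /exists_inP[y /ABP yP /andP[xy /eqP<-]].
    case: xP xy => [->|[v [e [eH ->]]]]; case: yP => [->|[u [f [fH ->]]]] xy.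
    * by rewrite eqxx in xy.
    * by rewrite ab cards1.
    * by rewrite setIC ab cards1.
    (* A common vertex of [a] adds one to [#|e :&: f|], giving 1 or 2. Otherwise the size is [k] if
       [e = f], and at most 1 if not. *)
    * have [uv|uv] := eqVneq v u.
        rewrite -uv bb card_b in xy *.
        have ef : e != f by apply: contra xy => /eqP->.
        by have := LH e f eH fH ef; case: #|_| => [|[|]].
      rewrite bb' //; have [->|ef] := eqVneq e f.
        by rewrite setIid SH // !inE eqxx !orbT.
      by have := LH e f eH fH ef; case: #|_| => [|[|]].
  + have wit r x y : x \in A :|: B -> y \in A :|: B -> x != y ->
        #|x :&: y| = r -> r \in intersection_sizes (A :|: B).
      move=> xAB yAB xy xyr; apply/exists_inP; exists x => //.
      by apply/exists_inP; exists y => //; rewrite xy xyr eqxx.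
    rewrite !inE => /or4P[] /eqP->.
    * apply: (wit _ (b o d1) (b o' d2)); rewrite ?bAB ?neq_b //.
      by rewrite bb' // d12 cards0.
    * apply: (wit _ a (b o d1)); rewrite ?bAB ?ab ?cards1 //.
      by apply/eqP => /setP/(_ (inl o')); rewrite in_al in_bl eq_sym (negbTE oo').
    * apply: (wit _ (b o m1) (b o m2)); rewrite ?bAB ?bb ?card_b ?m12 //.
      (* Were the two edges equal, their common size [k.+1] would be 2, against [1 < k]. *)
      apply/eqP => bm; have : #|b o m1 :&: b o m2| = 2 by rewrite bb card_b m12.
      by rewrite bm setIid card_b SH // => -[kE]; rewrite kE in k1.
    * by apply: (wit _ (b o d1) (b o' d1)); rewrite ?bAB ?neq_b ?bb' ?setIid ?SH.
- split.
  + pose f (x : V) : 'I_3 :=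
      match x with
      | inl v => if v == o then ord0 else Ordinal (isT : 1 < 3)
      | inr _ => ord_max
      end.
    exists f => _ /ABP[->|[v [e [eH ->]]]] [c fc].
    * have := fc _ (in_al o').
      by rewrite -(fc _ (in_al o)) /f eqxx eq_sym (negbTE oo').
    * have /card_gt0P[w we] : 0 < #|e| by rewrite SH // ltnW.
      have := fc (inl v); rewrite in_bl -(fc (inr w)) ?in_br // => /(_ (eqxx v)).
      by rewrite /f; case: ifP.
  + move=> m [f pf]; rewrite leqNgt ltnS; apply/negP => le_m2.
    (* With [m <= 2], a color is determined by whether it is 0, so [g] has the same color classes as
       [f]. *)
    pose g x := f x == 0 :> nat.
    have f2 x : f x < 2 by apply: leq_trans (ltn_ord _) le_m2.
    have gP x y : g x = g y -> f x = f y.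
      rewrite /g => gxy; apply: val_inj; move: gxy (f2 x) (f2 y) => /=.
      by case: (nat_of_ord (f x)) => [|[|?]]; case: (nat_of_ord (f y)) => [|[|?]].
    have notmono x : x \in A :|: B ->
        forall c, ~ (forall y, y \in x -> g y = c).
      move=> xAB c gc; apply: (pf x xAB).
      have /card_gt0P[z zx] : 0 < #|x|.
        by move/ABP: xAB => [->|[v [e [eH ->]]]]; rewrite ?card_a ?card_b.
      by exists (f z) => y yx; apply: gP; rewrite !gc.
    have [e eH [c ec]] := FH (fun w => g (inr w)).
    apply: (notmono a aAB (~~ c)) => -[v _|w]; last by rewrite in_ar.
    apply: contra_not_eq (notmono _ (bAB v e eH) c) => gv.
    case=> [u|w]; rewrite ?in_bl ?in_br; last exact: ec.
    by move=> /eqP->; move: gv; case: (g _) c {ec} => -[].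
Qed.
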